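(* Let $\mathcal M$ be a (non-split) supermanifold of dimension $m|n$ and let $\mathcal P$, with covering morphisms $\mathsf p^{(k)}:\mathcal P^{(k)}\to\mathcal M$, be its $\mathbb Z^{\ge0}$-covering. Then the morphism of sheaves of superalgebras $$(\mathsf p^{(k)})^*:\mathcal O_{\mathcal M}\to\mathcal O_{\mathcal P^{(k)}},\qquad k\ge n,$$ is injective.
   Context: $\mathbb K$ is $\mathbb R$ or $\mathbb C$; supermanifolds are smooth or complex-analytic in the sense of Berezin–Leites ($\mathbb Z_2$-graded locally ringed spaces $\mathcal M=(\mathcal M_0,\mathcal O_{\mathcal M})$ locally isomorphic to superdomains $(U,\mathcal F_U\otimes\bigwedge(\mathbb K^n)^* )$, $U\subset\mathbb K^m$ open; dimension $m|n$ means $m$ even and $n$ odd coordinates). A supermanifold is split if $\mathcal O_{\mathcal M}\simeq\bigwedge\mathcal E$ for a locally free sheaf $\mathcal E$ on $\mathcal M_0$ and non-split otherwise; the parenthetical ''(non-split)'' indicates that $\mathcal M$ is allowed to be non-split. Graded manifolds. A graded manifold of degree $r$ is a $\mathbb Z$-graded ringed space locally isomorphic to a graded domain $(\mathcal V_0,\mathcal F_{\mathcal V_0}\otimes_{S^*(V_0)}S^*(V))$, where $V=V_0\oplus\dots\oplus V_r$, elements of $V_i$ have weight $i$ and parity $i\bmod 2$, $\mathcal V_0\subset V_0^*$ is open and $S^*$ is the super-symmetric algebra (transition maps being $\mathbb Z$-graded and, on weight-$0$ functions, usual pullbacks). Keeping only coordinates of weight $\le r'$ gives a projection $\mathrm{pr}^r_{r'}$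 to a graded manifold of degree $r'$. $\mathcal P=\varprojlim\mathcal P_r$ denotes an inverse limit of graded manifolds $\mathcal P_r$ of degree $r$ with common base and $\mathrm{pr}^r_{r-1}(\mathcal P_r)=\mathcal P_{r-1}$, with structure sheaf $\bigcup_r\mathcal O_{\mathcal P_r}$; $\mathcal I_k\subset\mathcal O_{\mathcal P}$ is the ideal sheaf generated by functions of weight $\ge k+1$ and $\mathcal P^{(k)}=(\mathcal P_0,\mathcal O_{\mathcal P}/\mathcal I_k)$. $\mathbb Z^{\ge0}$-covering of $\mathcal M$: such a $\mathcal P$ with base $\mathcal P_0=\mathcal M_0$ and a family $\mathsf p^{(k)}:\mathcal P^{(k)}\to\mathcal M$, $k\ge0$, of morphisms of $\mathbb Z_2$-graded ringed spaces, compatible with the projections $\mathcal O_{\mathcal P}/\mathcal I_{k+1}\to\mathcal O_{\mathcal P}/\mathcal I_k$, such that there are atlases $\{\mathcal U_\lambda\}$ of $\mathcal M$ and $\{\mathcal V_\lambda=\varprojlim(\mathcal V_\lambda)_r\}$ of $\mathcal P$ with $(\mathcal U_\lambda)_0=(\mathcal V_\lambda)_0$, coordinates $(x_a,\xi_b)$ (even, odd) on $\mathcal U_\lambda$ and graded coordinates $(y_a^s,\eta_b^t)$ on $\mathcal V_\lambda$ ($s\ge0$ even, $t>0$ odd, of weights $s,t$; those with $s,t\le r$ being graded coordinates of $(\mathcal V_\lambda)_r$ for every $r$) with $\mathrm{pr}_s\circ(\mathsf p^{(k)})^*(x_a)=y_a^s$, $\mathrm{pr}_t\circ(\mathsf p^{(k)})^*(\xi_b)=\eta_b^t$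 for all $s,t\le k$, $\mathrm{pr}_q$ being the projection onto the weight-$q$ component. *)

(* Defs.v *)
From HB Require Import structures.
From mathcomp Require Import all_boot all_order all_algebra.
From mathcomp Require Import all_classical all_reals all_analysis.
From mathcomp Require Import complex ring.

Set Implicit Arguments.
Unset Strict Implicit.
Unset Printing Implicit Defensive.

Import Order.TTheory GRing.Theory Num.Theory.
Import numFieldNormedType.Exports.

Local Open Scope classical_set_scope.
Local Open Scope ring_scope.

Section Regular.
Variables (K : numFieldType) (m : nat).
Implicit Types (W : set 'rV[K]_m) (f g : 'rV[K]_m -> K).

(* All iterated partial derivatives of f of order at most k exist and are
   continuous at the points of W. *)
Fixpoint Ck (k : nat) W f : Prop :=
  (forall x, W x -> {for x, continuous f}) /\
  if k is j.+1 then
    forall i : 'I_m, (forall x, W x -> derivable f x (delta_mx 0 i)) /\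
      Ck j W ('D_(delta_mx 0 i) f)
  else True.

Lemma Ck_pred k W f : Ck k.+1 W f -> Ck k W f.
Proof.
elim: k f => [|k IH] f [cf df]; split=> // i.
by have [? /IH] := df i.
Qed.

Let near_ext W f g x : open W -> (forall x, W x -> f x = g x) -> W x ->
  {near x, f =1 g}.
Proof. by move=> oW fg Wx; apply: filterS (open_nbhs_nbhs (conj oW Wx)) => y /fg. Qed.

Let continuous_ext W f g x : open W -> (forall x, W x -> f x = g x) -> W x ->
  {for x, continuous f} -> {for x, continuous g}.
Proof.
move=> oW fg Wx; rewrite /prop_for /continuous_at (fg _ Wx).
by apply: cvg_trans; exact: near_eq_cvg (near_ext oW fg Wx).
Qed.

Lemma Ck_ext k W f g : open W -> (forall x, W x -> f x = g x) ->
  Ck k W f -> Ck k W g.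
Proof.
move=> oW; elim: k f g => [|k IH] f g fg [cf df]; split=> //.
- by move=> x Wx; exact: (continuous_ext oW fg Wx (cf _ Wx)).
- by move=> x Wx; exact: (continuous_ext oW fg Wx (cf _ Wx)).
- move=> i; have [dfi ci] := df i; split=> [x Wx|].
    by apply: near_eq_derivable (dfi _ Wx); exact: near_ext oW _ Wx.
  by apply: IH ci => x Wx; apply: near_eq_derive; exact: near_ext oW _ Wx.
Qed.

Lemma Ck_cst k W (a : K) : Ck k W (cst a).
Proof.
elim: k a => [|k IH] a; split=> //.
- by move=> x _; exact: cst_continuous.
- by move=> x _; exact: cst_continuous.
- move=> i; split=> [x _|]; first exact: derivable_cst.
  by rewrite (_ : 'D__ _ = cst 0) //; apply/funext => x; rewrite derive_cst.
Qed.

Lemma CkD k W f g : open W -> Ck k W f -> Ck k W g -> Ck k W (f + g).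
Proof.
move=> oW; elim: k f g => [|k IH] f g [cf df] [cg dg].
  by split=> // x Wx; apply: continuousD; [exact: cf|exact: cg].
split=> [x Wx|i]; first by apply: continuousD; [exact: cf|exact: cg].
have [dfi ci] := df i; have [dgi ei] := dg i; split=> [x Wx|].
  by apply: derivableD; [exact: dfi|exact: dgi].
apply: Ck_ext (IH _ _ ci ei) => // x Wx.
by rewrite deriveD; [ |exact: dfi|exact: dgi].
Qed.

Lemma CkM k W f g : open W -> Ck k W f -> Ck k W g -> Ck k W (f * g).
Proof.
move=> oW; elim: k f g => [|k IH] f g [cf df] [cg dg].
  by split=> // x Wx; apply: continuousM; [exact: cf|exact: cg].
split=> [x Wx|i]; first by apply: continuousM; [exact: cf|exact: cg].
have [dfi ci] := df i; have [dgi ei] := dg i; split=> [x Wx|].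
  by apply: derivableM; [exact: dfi|exact: dgi].
have Cf : Ck k W f by apply: Ck_pred; split.
have Cg : Ck k W g by apply: Ck_pred; split.
apply: Ck_ext (CkD oW (IH _ _ Cf ei) (IH _ _ Cg ci)) => // x Wx.
by rewrite deriveM; [ |exact: dfi|exact: dgi].
Qed.

Lemma Ck_coord k W (i : 'I_m) : Ck k W (fun x : 'rV[K]_m => x 0 i).
Proof.
have cc (x : 'rV[K]_m) : {for x, continuous (fun y : 'rV[K]_m => y 0 i)}.
  exact: coord_continuous.
case: k => [|k]; split=> // j; split=> [x _|].
  exact/diff_derivable/differentiable_coord.
rewrite (_ : 'D__ _ = cst ((delta_mx 0 j : 'rV[K]_m) 0 i)); first exact: Ck_cst.
apply/funext => x; apply: cvg_lim; first exact: norm_hausdorff.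
apply: cvg_near_cst; near=> h.
have h0 : h != 0 by near: h; exact: nbhs_dnbhs_neq.
by rewrite /= [X in X - _]mxE [X in X + _ - _]mxE addrK scalerA mulVf ?scale1r.
Unshelve. all: by end_near. Qed.

End Regular.

(* The super-symmetric algebra on a finite set G of homogeneous generators, g
   having weight w g and parity w g mod 2. A basis consists of the monomials
   with exponents a : {ffun G -> nat}, at most 1 at odd generators, the
   factors being taken in the order of enum_rank. An element is the family of
   its coefficients; finiteness of the support is imposed later, on sections
   (see model_section). *)
Section SuperSymmetric.
Variables (K : comPzRingType) (G : finType) (w : G -> nat).

Local Notation expo := {ffun G -> nat}.
Implicit Types (a b c d : expo).

Definition reduced a : bool := [forall g, odd (w g) ==> (a g <= 1)%N].

Definition monomial : Type := {a : expo | reduced a}.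

Definition weight a : nat := (\sum_g w g * a g)%N.

Definition dvd_expo a b : bool := [forall g, (a g <= b g)%N].

Definition sub_expo b a : expo := [ffun g => (b g - a g)%N].

Definition divisors_expo b : seq expo :=
  [seq [ffun g => val (d g)] | d : {dffun forall g, 'I_(b g).+1}].

(* The number of transpositions of odd factors needed to reorder the product of
   the monomials a and b. *)
Definition swaps a b : nat :=
  (\sum_(g | odd (w g)) \sum_(h | odd (w h) && (enum_rank h < enum_rank g)%N)
     a g * b h)%N.

Definition ssym : Type := monomial -> K.

(* Coefficients extended by 0 to the exponents that vanish in the algebra. *)
Definition coef (s : ssym) a : K := oapp s 0 (insub a).

Definition ssym_mul (s t : ssym) : ssym := fun u =>
  \sum_(a <- divisors_expo (val u))
    (-1) ^+ swaps a (sub_expo (val u) a) * (coef s a * coef t (sub_expo (val u) a)).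

Definition ssym_const (k : K) : ssym :=
  fun u => if val u == [ffun=> 0%N] then k else 0.

Lemma mem_divisors a b : (a \in divisors_expo b) = dvd_expo a b.
Proof.
apply/idP/forallP => [/mapP[d _ ->] g|ab].
  by rewrite ffunE -ltnS ltn_ord.
apply/mapP; exists [ffun g => inord (a g)]; first by rewrite mem_enum.
by apply/ffunP => g; rewrite !ffunE /= inordK // ltnS.
Qed.

Lemma uniq_divisors b : uniq (divisors_expo b).
Proof.
rewrite map_inj_uniq ?enum_uniq // => d e /ffunP de; apply/ffunP => g.
by apply: val_inj; have := de g; rewrite !ffunE.
Qed.

Lemma sum_divisors (F : expo -> K) b (r : seq expo) :
  uniq r -> (forall a, (a \in r) = dvd_expo a b) ->
  \sum_(a <- divisors_expo b) F a = \sum_(a <- r) F a.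
Proof.
move=> ur mr; apply: perm_big; apply: uniq_perm => //; first exact: uniq_divisors.
by move=> a; rewrite mem_divisors mr.
Qed.

Lemma reduced_dvd a b : dvd_expo a b -> reduced b -> reduced a.
Proof.
move=> /forallP ab /forallP rb; apply/forallP => g; apply/implyP => og.
exact: leq_trans (ab g) (implyP (rb g) og).
Qed.

Lemma dvd_sub_expo b a : dvd_expo (sub_expo b a) b.
Proof. by apply/forallP => g; rewrite ffunE leq_subr. Qed.

Lemma coefE (s : ssym) (u : monomial) : coef s (val u) = s u.
Proof. by rewrite /coef valK. Qed.

Lemma coef_out (s : ssym) a : ~~ reduced a -> coef s a = 0.
Proof. by move=> ra; rewrite /coef insubN. Qed.

Lemma coef_mul (s t : ssym) b : reduced b ->
  coef (ssym_mul s t) b = \sum_(a <- divisors_expo b)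
    (-1) ^+ swaps a (sub_expo b a) * (coef s a * coef t (sub_expo b a)).
Proof. by move=> rb; rewrite -[b in LHS](SubK monomial rb) coefE. Qed.

Lemma coefD (s t : ssym) a : coef (s + t) a = coef s a + coef t a.
Proof. by rewrite /coef; case: insub => //=; rewrite addr0. Qed.

Lemma weight_sub b a : dvd_expo a b -> weight b = (weight a + weight (sub_expo b a))%N.
Proof.
move=> /forallP ab; rewrite /weight -big_split; apply: eq_bigr => g _ /=.
by rewrite ffunE -mulnDr subnKC.
Qed.

Let swaps_addl a a' b b' : (forall g, b' g = a g + a' g)%N ->
  swaps b' b = (swaps a b + swaps a' b)%N.
Proof.
move=> e; rewrite /swaps -big_split; apply: eq_bigr => g _ /=.
by rewrite -big_split; apply: eq_bigr => h _; rewrite e mulnDl.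
Qed.

Let swaps_addr a a' b b' : (forall g, b' g = a g + a' g)%N ->
  swaps b b' = (swaps b a + swaps b a')%N.
Proof.
move=> e; rewrite /swaps -big_split; apply: eq_bigr => g _ /=.
by rewrite -big_split; apply: eq_bigr => h _; rewrite e mulnDr.
Qed.

Let add_expo a b : expo := [ffun g => (a g + b g)%N].

Let ssym_mulA : associative ssym_mul.
Proof.
move=> s t r; apply/funext => -[m rm]; rewrite /ssym_mul /=.
pose F a b c := (-1) ^+ (swaps a b + swaps a c + swaps b c) *
  (coef s a * (coef t b * coef r c)).
transitivity (\sum_(a <- divisors_expo m) \sum_(b <- divisors_expo (sub_expo m a))
   F a b (sub_expo (sub_expo m a) b)).
  apply: eq_big_seq => a; rewrite mem_divisors => am.
  rewrite coef_mul; last exact: reduced_dvd (dvd_sub_expo _ _) rm.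
  rewrite !mulr_sumr; apply: eq_big_seq => b.
  rewrite mem_divisors => /forallP bm; rewrite /F.
  rewrite (@swaps_addr b (sub_expo (sub_expo m a) b) _ (sub_expo m a)); last first.
    by move=> g; have := bm g; rewrite !ffunE => /subnKC.
  by rewrite !exprD; ring.
transitivity (\sum_(c <- divisors_expo m) \sum_(a <- divisors_expo c)
   F a (sub_expo c a) (sub_expo m c)); last first.
  apply: eq_big_seq => c; rewrite mem_divisors => cm.
  rewrite coef_mul; last exact: reduced_dvd cm rm.
  rewrite mulr_suml mulr_sumr; apply: eq_big_seq => a.
  rewrite mem_divisors => /forallP ac; rewrite /F.
  rewrite (@swaps_addl a (sub_expo c a) _ c); last first.
    by move=> g; rewrite !ffunE subnKC ?ac.
  by rewrite !exprD; ring.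
transitivity (\sum_(a <- divisors_expo m) \sum_(c <- divisors_expo m | dvd_expo a c)
   F a (sub_expo c a) (sub_expo m c)); last first.
  rewrite (exchange_big_dep predT) //=; apply: eq_big_seq => c.
  rewrite mem_divisors => /forallP cm; rewrite -big_filter; apply: perm_big.
  apply: uniq_perm; rewrite ?filter_uniq ?uniq_divisors // => a.
  rewrite mem_filter !mem_divisors andb_idr // => /forallP ac.
  by apply/forallP => g; exact: leq_trans (ac g) (cm g).
apply: eq_big_seq => a; rewrite mem_divisors => /forallP am.
rewrite -[RHS]big_filter.
transitivity (\sum_(c <- [seq add_expo a b | b <- divisors_expo (sub_expo m a)])
   F a (sub_expo c a) (sub_expo m c)).
  rewrite [RHS]big_map; apply: eq_bigr => /= b _; congr (F _ _ _).
    by apply/ffunP => g; rewrite !ffunE addKn.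
  by apply/ffunP => g; rewrite !ffunE subnDA.
apply: perm_big; apply: uniq_perm; rewrite ?filter_uniq ?uniq_divisors //.
  rewrite map_inj_uniq ?uniq_divisors // => b b' /ffunP e; apply/ffunP => g.
  by have := e g; rewrite !ffunE => /addnI.
move=> c; rewrite mem_filter mem_divisors; apply/mapP/andP.
  move=> [b]; rewrite mem_divisors => /forallP bm ->.
  by split; apply/forallP => g; have := bm g; have := am g;
     rewrite !ffunE ?leq_addr // => h; rewrite leq_subRL.
move=> [/forallP ac /forallP cm]; exists (sub_expo c a).
  by rewrite mem_divisors; apply/forallP => g; rewrite !ffunE leq_sub2r.
by apply/ffunP => g; rewrite !ffunE subnKC ?ac.
Qed.

Let zexp : expo := [ffun=> 0%N].

Let swaps0 a : swaps zexp a = 0%N.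
Proof. by rewrite /swaps !big1 // => g _; rewrite big1 // => h _; rewrite ffunE. Qed.

Let swapsr0 a : swaps a zexp = 0%N.
Proof.
rewrite /swaps !big1 // => g _; rewrite big1 // => h _.
by rewrite ffunE muln0.
Qed.

Let reduced0 : reduced zexp.
Proof. by apply/forallP => g; rewrite ffunE implybT. Qed.

Let coef_const k a : coef (ssym_const k) a = if a == zexp then k else 0.
Proof.
have [ra|ra] := boolP (reduced a).
  by rewrite -[a in LHS](SubK monomial ra) coefE.
by rewrite coef_out //; case: eqP ra => // ->; rewrite reduced0.
Qed.

Let ssym_mul_constl k (s : ssym) u : ssym_mul (ssym_const k) s u = k * s u.
Proof.
have z : zexp \in divisors_expo (val u).
  by rewrite mem_divisors; apply/forallP => g; rewrite ffunE.
rewrite /ssym_mul (big_rem _ z) /= big1_seq ?addr0 => [|a /=].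
  rewrite swaps0 mul1r coef_const eqxx (_ : sub_expo _ _ = val u) ?coefE //.
  by apply/ffunP => g; rewrite !ffunE subn0.
rewrite (rem_filter _ (uniq_divisors _)) mem_filter => /andP[/= az _].
by rewrite coef_const (negPf az) mul0r mulr0.
Qed.

Let ssym_mul_constr k (s : ssym) u : ssym_mul s (ssym_const k) u = s u * k.
Proof.
have z : val u \in divisors_expo (val u).
  by rewrite mem_divisors; apply/forallP.
rewrite /ssym_mul (big_rem _ z) /= big1_seq ?addr0 => [|a /=].
  rewrite (_ : sub_expo _ _ = zexp).
    by rewrite swapsr0 mul1r coef_const eqxx coefE.
  by apply/ffunP => g; rewrite !ffunE subnn.
rewrite (rem_filter _ (uniq_divisors _)) mem_filter mem_divisors.
move=> /andP[/= az /forallP au]; rewrite coef_const; case: eqP => [e|_].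
  case/eqP: az; apply/ffunP => g; apply/eqP; rewrite eqn_leq au /=.
  by have /ffunP/(_ g) := e; rewrite !ffunE => /eqP; rewrite subn_eq0.
by rewrite !mulr0.
Qed.

Let ssym_mul1l : left_id (ssym_const 1) ssym_mul.
Proof. by move=> s; apply/funext => u; rewrite ssym_mul_constl mul1r. Qed.

Let ssym_mul1r : right_id (ssym_const 1) ssym_mul.
Proof. by move=> s; apply/funext => u; rewrite ssym_mul_constr mulr1. Qed.

Let ssym_mulDl : left_distributive ssym_mul (@GRing.add (monomial -> K)).
Proof.
move=> s t r; apply/funext => u; transitivity (ssym_mul s r u + ssym_mul t r u) => //.
rewrite /ssym_mul -big_split.
by apply: eq_bigr => a _; rewrite coefD mulrDl mulrDr.
Qed.

Let ssym_mulDr : right_distributive ssym_mul (@GRing.add (monomial -> K)).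
Proof.
move=> s t r; apply/funext => u; transitivity (ssym_mul s t u + ssym_mul s r u) => //.
rewrite /ssym_mul -big_split.
by apply: eq_bigr => a _; rewrite coefD !mulrDr.
Qed.

HB.instance Definition _ := GRing.Zmodule.copy ssym (monomial -> K).
HB.instance Definition _ := GRing.Zmodule_isPzRing.Build ssym
  ssym_mulA ssym_mul1l ssym_mul1r ssym_mulDl ssym_mulDr.

Lemma ssym_mulE (s t : ssym) u : (s * t) u = \sum_(a <- divisors_expo (val u))
    (-1) ^+ swaps a (sub_expo (val u) a) * (coef s a * coef t (sub_expo (val u) a)).
Proof. by []. Qed.

Lemma ssym_constM k (s : ssym) u : (ssym_const k * s) u = k * s u.
Proof. exact: ssym_mul_constl. Qed.

Lemma ssymM_const k (s : ssym) u : (s * ssym_const k) u = s u * k.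
Proof. exact: ssym_mul_constr. Qed.

End SuperSymmetric.

Lemma Ck_subset (K : numFieldType) (m k : nat) (W V : set 'rV[K]_m)
  (f : 'rV[K]_m -> K) : V `<=` W -> Ck k W f -> Ck k V f.
Proof.
move=> VW; elim: k f => [|k IH] f [cf df]; split=> //.
- by move=> x /VW; exact: cf.
- by move=> x /VW; exact: cf.
- by move=> i; have [dfi /IH] := df i; split=> // x /VW; exact: dfi.
Qed.

Lemma differentiable_ext (K : numFieldType) (V W : normedModType K)
  (f g : V -> W) (x : V) :
  {near x, f =1 g} -> differentiable f x -> differentiable g x.
Proof.
move=> fg df; have [cf /eqaddoP ef] := (diff_locallyP _ _).1 df.
have fgx : f x = g x := nbhs_singleton fg.
have eg : g \o shift x = cst (g x) + 'd f x +o_ 0 id.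
  apply/eqaddoP => e e0; have := ef e e0; apply: filter_app.
  move: fg; rewrite [X in X -> _](near_shift 0) subr0; apply: filterS => y /=.
  by rewrite /cst fgx !fctE /= => ->.
by apply/diff_locallyP; rewrite (diff_unique cf eg).
Qed.

Inductive ground := RealGround | ComplexGround.

Definition scalars (R : realType) (c : ground) : numFieldType :=
  match c with RealGround => R | ComplexGround => R[i] end.

Section Smooth.
Variables (c : ground) (K : numFieldType) (m : nat).
Implicit Types (W : set 'rV[K]_m) (f g : 'rV[K]_m -> K).

(* C^infinity functions over the reals, holomorphic functions over the complex
   numbers (where differentiability is over K). *)
Definition smooth W f : Prop :=
  match c with
  | RealGround => forall k, Ck k W f
  | ComplexGround => forall x, W x -> differentiable f x
  end.

Lemma smooth_subset W V f : V `<=` W -> smooth W f -> smooth V f.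
Proof.
rewrite /smooth; case: c => [VW h k|VW h x /VW]; last exact: h.
exact: Ck_subset VW (h k).
Qed.

Lemma smooth_ext W f g : open W -> (forall x, W x -> f x = g x) ->
  smooth W f -> smooth W g.
Proof.
rewrite /smooth; case: c => oW fg h; first by move=> k; exact: Ck_ext (h k).
move=> x Wx; apply: differentiable_ext (h _ Wx).
by apply: filterS (open_nbhs_nbhs (conj oW Wx)) => y /fg.
Qed.

Lemma smooth_cst W (a : K) : smooth W (cst a).
Proof. by rewrite /smooth; case: c => *; [exact: Ck_cst|exact: differentiable_cst]. Qed.

Lemma smoothD W f g : open W -> smooth W f -> smooth W g -> smooth W (f + g).
Proof.
rewrite /smooth; case: c => oW hf hg; first by move=> k; exact: CkD.
by move=> x Wx; apply: differentiableD; [exact: hf|exact: hg].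
Qed.

Lemma smoothM W f g : open W -> smooth W f -> smooth W g -> smooth W (f * g).
Proof.
rewrite /smooth; case: c => oW hf hg; first by move=> k; exact: CkM.
by move=> x Wx; apply: differentiableM; [exact: hf|exact: hg].
Qed.

Lemma smooth_coord W (i : 'I_m) : smooth W (fun x : 'rV[K]_m => x 0 i).
Proof.
rewrite /smooth; case: c => *; first exact: Ck_coord.
exact: differentiable_coord.
Qed.

End Smooth.

(* Unital associative K-algebras, as rings with a central ring morphism from K.
   algType is not used because it excludes the zero ring, which is the algebra
   of sections over the empty open set. *)
Record algebra (K : comPzRingType) := Algebra {
  alg_ring :> pzRingType;
  alg_scalar : {rmorphism K -> alg_ring};
  alg_scalarC : forall a x, alg_scalar a * x = x * alg_scalar a
}.

Record alg_hom (K : comPzRingType) (A B : algebra K) := AlgHom {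
  alg_map :> {rmorphism A -> B};
  alg_mapZ : forall a, alg_map (alg_scalar A a) = alg_scalar B a
}.

Record opens (T : topologicalType) := Opens {
  oset :> set T;
  open_oset : open oset
}.

Definition locally_on (T : topologicalType) (U : opens T)
    (P : forall V : opens T, V `<=` U -> Prop) : Prop :=
  forall x, oset U x ->
    exists (V : opens T) (VU : V `<=` U), oset V x /\ P V VU.

(* Monoids of degrees, with the parity of a degree and the degree of an element
   of integer weight. All weights are nonnegative, so the Z-graded objects are
   indexed by nat. *)
Record weights := Weights {
  windex :> nmodType;
  parity : windex -> bool;
  of_nat : nat -> windex
}.

Definition Z2_weights : weights := @Weights bool id odd.
Definition Z_weights : weights := @Weights nat odd id.

(* Here pr i is the projection onto the component of degree i. *)
Record gpresheaf (K : comPzRingType) (I : weights) (T : topologicalType) :=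
  GPresheaf {
  sections :> opens T -> algebra K;
  res : forall U V : opens T, V `<=` U -> alg_hom (sections U) (sections V);
  res_id : forall (U : opens T) (UU : U `<=` U) f, res UU f = f;
  res_comp : forall (U V W : opens T) (VU : V `<=` U) (WV : W `<=` V) (WU : W `<=` U) f,
    res WV (res VU f) = res WU f;
  pr : forall U : opens T, I -> sections U -> sections U;
  prD : forall (U : opens T) i, {morph @pr U i : f g / f + g};
  prZ : forall (U : opens T) i a (f : sections U),
    pr i (alg_scalar (sections U) a * f) = alg_scalar (sections U) a * pr i f;
  res_pr : forall (U V : opens T) (VU : V `<=` U) i f, res VU (pr i f) = pr i (res VU f)
}.
Arguments res {K I T} _ {U V} VU.
Arguments pr {K I T} _ {U} i f.

Section Presheaves.
Variables (K : comPzRingType) (I : weights) (T : topologicalType).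
Variable (O : gpresheaf K I T).

Definition is_sheaf : Prop :=
  forall (J : Type) (U : opens T) (V : J -> opens T) (VU : forall j, V j `<=` U),
    (forall x, oset U x -> exists j, oset (V j) x) ->
    (forall f g : O U, (forall j, res O (VU j) f = res O (VU j) g) -> f = g) /\
    (forall s : forall j, O (V j),
      (forall i j (W : opens T) (Wi : W `<=` V i) (Wj : W `<=` V j),
        res O Wi (s i) = res O Wj (s j)) ->
      exists f : O U, forall j, res O (VU j) f = s j).

Definition homogeneous (U : opens T) (i : I) (f : O U) : Prop := pr O i f = f.

Definition has_parity (U : opens T) (e : bool) (f : O U) : Prop :=
  forall i : I, parity i != e -> pr O i f = 0.

(* The sheaf is the direct sum, as a sheaf, of its homogeneous components: a
   section is locally a finite sum of its components. *)
Definition is_superalgebra : Prop :=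
  [/\ forall (U : opens T) (i j : I) (f : O U),
        pr O i (pr O j f) = if i == j then pr O j f else 0,
      forall (U : opens T) (f : O U), locally_on (fun V (VU : V `<=` U) =>
        exists s : seq I, uniq s /\ res O VU f = \sum_(i <- s) res O VU (pr O i f)),
      forall (U : opens T) (i j : I) (f g : O U),
        homogeneous i f -> homogeneous j g -> homogeneous (i + j) (f * g) &
      forall (U : opens T) (i j : I) (f g : O U),
        homogeneous i f -> homogeneous j g ->
        f * g = (-1) ^+ (parity i && parity j) * (g * f)].

Definition invertible_at (U : opens T) (x : T) (f : O U) : Prop :=
  exists (V : opens T) (VU : V `<=` U), oset V x /\
    exists g : O V, res O VU f * g = 1 /\ g * res O VU f = 1.

(* The stalks are nonzero and their non-invertible elements are closed under
   addition. *)
Definition local_stalks : Prop :=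
  forall (U : opens T) (x : T), oset U x ->
    ~ invertible_at x (0 : O U) /\
    forall f g : O U, invertible_at x (f + g) ->
      invertible_at x f \/ invertible_at x g.

(* The ideal sheaf generated by the sections in S. *)
Definition ideal_sheaf (S : forall U : opens T, set (O U)) (U : opens T) (f : O U)
    : Prop :=
  locally_on (fun V (VU : V `<=` U) =>
    exists (N : nat) (a g b : 'I_N -> O V),
      (forall i, S V (g i)) /\ res O VU f = \sum_(i < N) a i * g i * b i).

End Presheaves.

(* Morphisms over the identity of the base. *)
Record sheaf_hom (K : comPzRingType) (I J : weights) (T : topologicalType)
    (O : gpresheaf K I T) (O' : gpresheaf K J T) := SheafHom {
  hom_on :> forall U : opens T, alg_hom (O U) (O' U);
  hom_res : forall (U V : opens T) (VU : V `<=` U) (f : O U),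
    res O' VU (hom_on U f) = hom_on V (res O VU f)
}.

Definition weight_preserving (K : comPzRingType) (I : weights)
    (T : topologicalType) (O O' : gpresheaf K I T) (F : sheaf_hom O O') : Prop :=
  forall (U : opens T) (i : I) (f : O U), F U (pr O i f) = pr O' i (F U f).

Definition parity_preserving (K : comPzRingType) (I J : weights)
    (T : topologicalType) (O : gpresheaf K I T) (O' : gpresheaf K J T)
    (F : sheaf_hom O O') : Prop :=
  forall (U : opens T) (e : bool) (f : O U),
    has_parity e f -> has_parity e (F U f).

(* Isomorphisms of graded ringed spaces from (U, OX) onto (Om, OY). *)
Record space_iso (K : comPzRingType) (I : weights) (X Y : topologicalType)
    (OX : gpresheaf K I X) (OY : gpresheaf K I Y) (U : opens X) (Om : opens Y) :=
  SpaceIso {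
  iso_fun : X -> Y;
  iso_inv : Y -> X;
  iso_img : iso_fun @` U = Om;
  iso_funK : forall x, oset U x -> iso_inv (iso_fun x) = x;
  iso_cont : {within U, continuous iso_fun};
  iso_inv_cont : {within Om, continuous iso_inv};
  iso_map : forall (V : opens X) (W : opens Y),
    V `<=` U -> iso_fun @` V = W -> alg_hom (OY W) (OX V);
  iso_map_bij : forall (V : opens X) (W : opens Y) (VU : V `<=` U) (VW : iso_fun @` V = W),
    bijective (iso_map VU VW);
  iso_map_res : forall (V V' : opens X) (W W' : opens Y)
      (VU : V `<=` U) (VW : iso_fun @` V = W)
      (VU' : V' `<=` U) (VW' : iso_fun @` V' = W')
      (V'V : V' `<=` V) (W'W : W' `<=` W) (s : OY W),
    res OX V'V (iso_map VU VW s) = iso_map VU' VW' (res OY W'W s);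
  iso_map_pr : forall (V : opens X) (W : opens Y) (VU : V `<=` U) (VW : iso_fun @` V = W) i (s : OY W),
    pr OX i (iso_map VU VW s) = iso_map VU VW (pr OY i s)
}.

Arguments iso_map {K I X Y OX OY U Om} _ {V W} VU VW.

Definition iso_pullback (K : comPzRingType) (I : weights)
    (X Y : topologicalType) (OX : gpresheaf K I X) (OY : gpresheaf K I Y)
    (U : opens X) (Om : opens Y) (chi : space_iso OX OY U Om) :
    alg_hom (OY Om) (OX U) :=
  iso_map chi (@subset_refl _ U) (iso_img chi).

Section Model.
Variables (R : realType) (c : ground) (m : nat) (G : finType) (w : G -> nat).
Local Notation K := (scalars R c).
Local Notation Km := 'rV[K]_m.
Local Notation S := (ssym K w).

(* 'valL_0 f is the extension of f by 0 outside W. *)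
Definition regular (W : opens Km) (f : W -> K) : Prop := smooth c W ('valL_0 f).

(* The sections over W of F tensored with the super-symmetric algebra: locally
   finite sums of monomials with coefficients in F. As the weights of the
   generators will be positive, bounding the weight bounds the number of
   monomials. *)
Definition model_section (W : opens Km) (s : W -> S) : Prop :=
  (forall u : monomial w, regular (fun y => s y u)) /\
  (forall x : W, exists N : nat, \forall y \near val x,
     forall z : W, val z = y ->
     forall u : monomial w, (N < weight w (val u))%N -> s z u = 0).


Lemma valL_val (W : set Km) (f : W -> K) (z : W) : 'valL_0 f (val z) = f z.
Proof. by rewrite /valL_ /= oinv_set_val valK. Qed.

Lemma regular_ext (W : opens Km) (F : Km -> K) (f : W -> K) :
  smooth c W F -> (forall z : W, F (val z) = f z) -> regular f.
Proof.
move=> sF Ff; apply: smooth_ext sF; first exact: open_oset.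
move=> x Wx; have -> : x = val (exist _ x (mem_set Wx) : W) by [].
by rewrite valL_val.
Qed.

Lemma regular_cst (W : opens Km) (a : K) : regular (fun _ : W => a).
Proof. by apply: (regular_ext (smooth_cst c W a)). Qed.

Lemma regularD (W : opens Km) (f g : W -> K) :
  regular f -> regular g -> regular (fun z => f z + g z).
Proof.
move=> rf rg; apply: (regular_ext (smoothD (open_oset W) rf rg)) => z.
by rewrite !fctE !valL_val.
Qed.

Lemma regularM (W : opens Km) (f g : W -> K) :
  regular f -> regular g -> regular (fun z => f z * g z).
Proof.
move=> rf rg; apply: (regular_ext (smoothM (open_oset W) rf rg)) => z.
by rewrite !fctE !valL_val.
Qed.

Lemma regular_sum (W : opens Km) (T : Type) (r : seq T) (f : T -> W -> K) :
  (forall a, regular (f a)) -> regular (fun z => \sum_(a <- r) f a z).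
Proof.
move=> rf; elim: r => [|a r IH].
  rewrite (_ : (fun _ => _) = fun _ => 0); first exact: regular_cst.
  by apply/funext => z; rewrite big_nil.
rewrite (_ : (fun _ => _) = fun z => f a z + \sum_(b <- r) f b z).
  exact: regularD.
by apply/funext => z; rewrite big_cons.
Qed.

Let regular_coef (W : opens Km) (s : W -> S) (a : {ffun G -> nat}) :
  model_section s -> regular (fun z => coef (s z) a).
Proof.
move=> [rs _]; have [ra|ra] := boolP (reduced w a).
  rewrite (_ : (fun _ => _) = fun z => s z (Sub a ra)); first exact: rs.
  by apply/funext => z; rewrite /coef insubT.
rewrite (_ : (fun _ => _) = fun=> 0); first exact: regular_cst.
by apply/funext => z; rewrite coef_out.
Qed.

Let coef_bound (W : opens Km) (s : W -> S) (z : W) (N : nat) :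
  (forall u : monomial w, (N < weight w (val u))%N -> s z u = 0) ->
  forall a, (N < weight w a)%N -> coef (s z) a = 0.
Proof.
move=> h a Na; have [ra|ra] := boolP (reduced w a); last by rewrite coef_out.
by rewrite /coef insubT /= h.
Qed.

Definition model_pred (W : opens Km) : {pred W -> S} :=
  fun s => `[< model_section s >].

Let model_subring (W : opens Km) : subring_closed (@model_pred W).
Proof.
split.
- apply/asboolP; split=> [u|x]; first exact: regular_cst.
  exists 0%N; near=> y => z _ u; rewrite [LHS](_ : _ = ssym_const (1 : K) u) // /ssym_const.
  by case: ifP => // /eqP ->; rewrite /weight big1 // => g _; rewrite ffunE muln0.
- move=> s t /asboolP hs /asboolP ht; apply/asboolP; split=> [u|x].
    rewrite (_ : (fun _ => _) = fun z => s z u + (-1) * t z u).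
      apply: regularD; first exact: hs.1.
      by apply: regularM; [exact: regular_cst|exact: ht.1].
    by apply/funext => z; rewrite mulN1r.
  have [[N hN] [N' hN']] := (hs.2 x, ht.2 x); exists (maxn N N').
  near=> y => z zy u; rewrite gtn_max => /andP[Nu N'u].
  rewrite [LHS](_ : _ = s z u - t z u) //.
  rewrite (near hN y _ z zy u) // (near hN' y _ z zy u) ?subrr //.
- move=> s t /asboolP hs /asboolP ht; apply/asboolP; split=> [u|x].
    rewrite (_ : (fun _ => _) = fun z => \sum_(a <- divisors_expo (val u))
      (-1) ^+ swaps w a (sub_expo (val u) a) *
      (coef (s z) a * coef (t z) (sub_expo (val u) a))) //.
    apply: regular_sum => a; apply: regularM; first exact: regular_cst.
    by apply: regularM; exact: regular_coef.
  have [[N hN] [N' hN']] := (hs.2 x, ht.2 x); exists (N + N')%N.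
  near=> y => z zy u Nu.
  rewrite [LHS](_ : _ = (s z * t z) u) // ssym_mulE big1_seq // => a /andP[_].
  rewrite mem_divisors => /weight_sub -/(_ w) e.
  have [aN|aN] := ltnP N (weight w a).
    rewrite (coef_bound _ aN) ?mul0r ?mulr0 //.
    exact: (near hN y _ z zy).
  have bN : (N' < weight w (sub_expo (val u) a))%N.
    rewrite -(ltn_add2l (weight w a)) -e; apply: leq_ltn_trans Nu.
    by rewrite leq_add2r.
  rewrite (coef_bound _ bN) ?mulr0 //.
  exact: (near hN' y _ z zy).
Unshelve. all: by end_near. Qed.

Record model (W : opens Km) : Type := Model {
  model_val :> W -> S;
  model_valP : model_val \in @model_pred W
}.
HB.instance Definition _ (W : opens Km) := [isSub for @model_val W].
HB.instance Definition _ (W : opens Km) := [Choice of model W by <:].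
HB.instance Definition _ (W : opens Km) :=
  GRing.SubChoice_isSubPzRing.Build _ _ (model W) (@model_subring W).


Let model_inj (W : opens Km) (s t : model W) : (forall z u, s z u = t z u) -> s = t.
Proof. by move=> st; apply: val_inj; do 2 apply/funext => ?; exact: st. Qed.

Lemma model_secP (W : opens Km) (s : model W) : model_section s.
Proof. exact: asboolW (model_valP s). Qed.

Definition mk_model (W : opens Km) (s : W -> S) (h : model_section s) : model W :=
  Model (asboolT h).

Let scalar_subproof (W : opens Km) (k : W -> K) :
  regular k -> model_section (fun z : W => ssym_const (k z) : S).
Proof.
move=> rk; split=> [u|x].
  rewrite /ssym_const; case: (val u == _); [exact: rk|exact: regular_cst].
exists 0%N; near=> y => z _ u; rewrite /ssym_const.
by case: ifP => // /eqP ->; rewrite /weight big1 // => g _; rewrite ffunE muln0.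
Unshelve. all: by end_near. Qed.

(* A function, seen as a section of weight 0. *)
Definition model_fun (W : opens Km) (k : W -> K) (rk : regular k) : model W :=
  mk_model (scalar_subproof rk).

Definition model_scalar (W : opens Km) (k : K) : model W :=
  model_fun (regular_cst W k).

Let model_scalar_additive (W : opens Km) : {morph @model_scalar W : a b / a - b}.
Proof.
move=> a b; apply: model_inj => z u.
rewrite [RHS](_ : _ = model_scalar W a z u - model_scalar W b z u) //=.
by rewrite /ssym_const; case: ifP => // _; rewrite subrr.
Qed.

Let model_scalar_mult (W : opens Km) : monoid_morphism (@model_scalar W).
Proof.
split=> [|a b]; apply: model_inj => z u //.
rewrite [RHS](_ : _ = (model_scalar W a z * model_scalar W b z) u) //=.
by rewrite ssym_constM /ssym_const; case: ifP => // _; rewrite mulr0.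
Qed.

HB.instance Definition _ (W : opens Km) :=
  GRing.isZmodMorphism.Build K (model W) (@model_scalar W) (@model_scalar_additive W).
HB.instance Definition _ (W : opens Km) :=
  GRing.isMonoidMorphism.Build K (model W) (@model_scalar W) (@model_scalar_mult W).

Let model_scalarE (W : opens Km) a (s : model W) z u :
  (model_scalar W a * s) z u = a * s z u.
Proof. exact: ssym_constM. Qed.

Let model_scalarC (W : opens Km) a (s : model W) :
  model_scalar W a * s = s * model_scalar W a.
Proof.
apply: model_inj => z u; rewrite model_scalarE mulrC.
by rewrite [RHS](_ : _ = (s z * ssym_const a) u) // ssymM_const.
Qed.

Definition model_algebra (W : opens Km) : algebra K :=
  @Algebra K (model W) (@model_scalar W) (@model_scalarC W).

Definition sub_incl (V W : set Km) (VW : V `<=` W) (z : V) : W :=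
  exist _ (val z) (mem_set (VW _ (set_mem (valP z)))).

Let model_res_subproof (W V : opens Km) (VW : V `<=` W) (s : model W) :
  model_section (s \o sub_incl VW).
Proof.
have [rs ls] := model_secP s; split=> [u|x].
  apply: (regular_ext (smooth_subset VW (rs u))) => z.
  by rewrite -[val z]/(val (sub_incl VW z)) valL_val.
have [N hN] := ls (sub_incl VW x); exists N; near=> y => z zy u Nu.
exact: (near hN y _ (sub_incl VW z) zy).
Unshelve. all: by end_near. Qed.

Definition model_res (W V : opens Km) (VW : V `<=` W) (s : model W) : model V :=
  mk_model (model_res_subproof VW s).

Let model_res_additive (W V : opens Km) (VW : V `<=` W) :
  {morph model_res VW : s t / s - t}.
Proof. by move=> s t; apply: model_inj. Qed.

Let model_res_mult (W V : opens Km) (VW : V `<=` W) :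
  monoid_morphism (model_res VW).
Proof. by split=> [|s t]; apply: model_inj. Qed.

HB.instance Definition _ (W V : opens Km) (VW : V `<=` W) :=
  GRing.isZmodMorphism.Build (model W) (model V) (model_res VW)
    (model_res_additive VW).
HB.instance Definition _ (W V : opens Km) (VW : V `<=` W) :=
  GRing.isMonoidMorphism.Build (model W) (model V) (model_res VW)
    (model_res_mult VW).

Let model_res_scalar (W V : opens Km) (VW : V `<=` W) a :
  model_res VW (model_scalar W a) = model_scalar V a.
Proof. exact: model_inj. Qed.

Definition model_res_hom (W V : opens Km) (VW : V `<=` W) :
    alg_hom (model_algebra W) (model_algebra V) :=
  @AlgHom K (model_algebra W) (model_algebra V) (model_res VW)
    (model_res_scalar VW).

Variable I : weights.

Let model_pr_subproof (W : opens Km) (i : I) (s : model W) :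
  model_section (fun z u => if of_nat I (weight w (val u)) == i then s z u else 0).
Proof.
have [rs ls] := model_secP s; split=> [u|x].
  by case: (of_nat I (weight w (val u)) == i); [exact: rs|exact: regular_cst].
have [N hN] := ls x; exists N; near=> y => z zy u Nu.
by case: ifP => // _; exact: (near hN y).
Unshelve. all: by end_near. Qed.

Definition model_pr (W : opens Km) (i : I) (s : model W) : model W :=
  mk_model (model_pr_subproof i s).

Let sub_incl_id (W : set Km) (WW : W `<=` W) (z : W) : sub_incl WW z = z.
Proof. exact: val_inj. Qed.

Let sub_incl_comp (V W X : set Km) (VW : V `<=` W) (XV : X `<=` V) (XW : X `<=` W)
  (z : X) : sub_incl VW (sub_incl XV z) = sub_incl XW z.
Proof. exact: val_inj. Qed.

Let model_res_id (W : opens Km) (WW : W `<=` W) (s : model W) : model_res WW s = s.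
Proof. by apply: model_inj => z u; rewrite /= sub_incl_id. Qed.

Let model_res_comp (U V W : opens Km) (VU : V `<=` U) (WV : W `<=` V)
  (WU : W `<=` U) (s : model U) :
  model_res WV (model_res VU s) = model_res WU s.
Proof. by apply: model_inj => z u; rewrite /= sub_incl_comp. Qed.

Let model_prD (W : opens Km) i : {morph @model_pr W i : s t / s + t}.
Proof.
move=> s t; apply: model_inj => z u.
rewrite [RHS](_ : _ = model_pr i s z u + model_pr i t z u) //=.
by case: ifP => // _; rewrite addr0.
Qed.

Let model_prZ (W : opens Km) i a (s : model W) :
  model_pr i (model_scalar W a * s) = model_scalar W a * model_pr i s.
Proof.
apply: model_inj => z u; rewrite model_scalarE.
transitivity (if of_nat I (weight w (val u)) == i
  then (model_scalar W a * s) z u else 0) => //.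
by rewrite model_scalarE /=; case: ifP => // _; rewrite mulr0.
Qed.

Let model_res_pr (W V : opens Km) (VW : V `<=` W) i (s : model W) :
  model_res VW (model_pr i s) = model_pr i (model_res VW s).
Proof. exact: model_inj. Qed.

Definition model_sheaf : gpresheaf K I Km :=
  @GPresheaf K I Km model_algebra model_res_hom
    model_res_id model_res_comp model_pr model_prD model_prZ model_res_pr.

Let regular_coord (W : opens Km) (a : 'I_m) : regular (fun z : W => (val z) 0 a).
Proof. exact: (regular_ext (smooth_coord c W a)). Qed.

Definition base_coord (W : opens Km) (a : 'I_m) : model_sheaf W :=
  model_fun (regular_coord W a).

Let gen_subproof (W : opens Km) (g : G) :
  model_section (fun (_ : W) (u : monomial w) =>
    if val u == [ffun h => nat_of_bool (h == g)] then 1 else 0 : K).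
Proof.
split=> [u|x]; first exact: regular_cst.
exists (weight w [ffun h => nat_of_bool (h == g)]); near=> y => z _ u.
by case: ifP => // /eqP ->; rewrite ltnn.
Unshelve. all: by end_near. Qed.

Definition gen_coord (W : opens Km) (g : G) : model_sheaf W :=
  mk_model (gen_subproof W g).

End Model.

(* Smooth or holomorphic transition maps, and the fact that a chart acts on
   functions by pullback, need not be required: a morphism of sheaves of
   K-algebras, preserving the degree, between sheaves of functions over a
   homeomorphism is the pullback, since c is the value of f at x exactly when
   f - c is not invertible near x. *)

Section Domains.
Variables (R : realType) (c : ground).
Local Notation K := (scalars R c).

Definition superdomain (m n : nat) : gpresheaf K Z2_weights 'rV[K]_m :=
  @model_sheaf R c m 'I_n (fun=> 1%N) Z2_weights.

(* Even coordinates for e = false and odd coordinates for e = true. *)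
Definition super_coord (m n : nat) (W : opens 'rV[K]_m) (e : bool) :
    'I_(if e then n else m) -> superdomain m n W :=
  match e return 'I_(if e then n else m) -> superdomain m n W with
  | true => fun b => gen_coord (fun=> 1%N) Z2_weights W b
  | false => fun a => base_coord (fun=> 1%N) Z2_weights W a
  end.

(* The coordinates of weight 1, ..., r, d i being the dimension of V_i. *)
Definition generator (r : nat) (d : nat -> nat) : finType :=
  {i : 'I_r & 'I_(d i.+1)}.

Definition gen_weight (r : nat) (d : nat -> nat) (g : generator r d) : nat :=
  (tag g).+1.

Definition graded_domain (r : nat) (d : nat -> nat) :
    gpresheaf K Z_weights 'rV[K]_(d 0%N) :=
  @model_sheaf R c (d 0%N) (generator r d) (@gen_weight r d) Z_weights.

Definition graded_coord (r : nat) (d : nat -> nat) (W : opens 'rV[K]_(d 0%N))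
    (i : nat) : (i <= r)%N -> 'I_(d i) -> graded_domain r d W :=
  match i return (i <= r)%N -> 'I_(d i) -> graded_domain r d W with
  | 0 => fun _ a => base_coord (@gen_weight r d) Z_weights W a
  | j.+1 => fun jr a => gen_coord (@gen_weight r d) Z_weights W
      (Tagged (fun i : 'I_r => 'I_(d i.+1)) (a : 'I_(d (Ordinal jr).+1)))
  end.

(* The section s only involves coordinates of weight at most r'. *)
Definition weights_upto (r : nat) (d : nat -> nat) (r' : nat)
    (W : opens 'rV[K]_(d 0%N)) (s : graded_domain r d W) : Prop :=
  forall (z : W) (u : monomial (@gen_weight r d)),
    (exists g, (r' < gen_weight g)%N /\ (0 < val u g)%N) ->
    model_val s z u = 0.

Record supermanifold (m n : nat) := Supermanifold {
  sm_space : topologicalType;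
  sm_sheaf : gpresheaf K Z2_weights sm_space;
  sm_isheaf : is_sheaf sm_sheaf;
  sm_super : is_superalgebra sm_sheaf;
  sm_local : local_stalks sm_sheaf;
  sm_chart : forall x : sm_space, exists (U : opens sm_space)
    (Om : opens 'rV[K]_m), oset U x /\
    inhabited (space_iso sm_sheaf (superdomain m n) U Om)
}.

Section GradedManifolds.
Variable T : topologicalType.
Implicit Type O : gpresheaf K Z_weights T.

Definition graded_manifold (r : nat) O : Prop :=
  [/\ is_sheaf O, is_superalgebra O &
    forall x : T, exists (d : nat -> nat) (U : opens T) (Om : opens 'rV[K]_(d 0%N)),
      oset U x /\ inhabited (space_iso O (graded_domain r d) U Om)].

(* The structure sheaf of the projection to degree r' of a graded manifold O of
   degree r, as a subsheaf of O. *)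
Definition projected (r r' : nat) O (U : opens T) (f : O U) : Prop :=
  locally_on (fun V (VU : V `<=` U) =>
    exists (d : nat -> nat) (Om : opens 'rV[K]_(d 0%N))
      (chi : space_iso O (graded_domain r d) V Om) (s : graded_domain r d Om),
      weights_upto r' s /\ iso_pullback chi s = res O VU f).

(* An inverse system of graded manifolds with base T; its limit has the union of
   the structure sheaves as structure sheaf. *)
Record graded_limit := GradedLimit {
  term : nat -> gpresheaf K Z_weights T;
  termP : forall r, graded_manifold r (term r);
  term_pr : forall r, sheaf_hom (term r) (term r.+1);
  term_pr_weight : forall r, weight_preserving (term_pr r);
  term_pr_inj : forall r U, injective (term_pr r U);
  term_prP : forall r (U : opens T) (f : term r.+1 U),
    projected r.+1 r f <-> exists g : term r U, term_pr r U g = f;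
  limit : gpresheaf K Z_weights T;
  limit_isheaf : is_sheaf limit;
  limit_super : is_superalgebra limit;
  limit_in : forall r, sheaf_hom (term r) limit;
  limit_in_weight : forall r, weight_preserving (limit_in r);
  limit_in_inj : forall r U, injective (limit_in r U);
  limit_in_pr : forall r U g, limit_in r.+1 U (term_pr r U g) = limit_in r U g;
  limit_union : forall (U : opens T) (f : limit U),
    locally_on (fun V (VU : V `<=` U) =>
      exists r (g : term r V), limit_in r V g = res limit VU f)
}.

(* The ideal sheaf I_k generated by the functions of weight at least k + 1. *)
Definition higher_ideal (P : graded_limit) (k : nat) :
    forall U : opens T, set (limit P U) :=
  @ideal_sheaf K Z_weights T (limit P) (fun U =>
    [set g | exists q : nat, (k < q)%N /\ @homogeneous K Z_weights T _ U q g]).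

(* The quotient sheaf by I_k, as a sheaf with a locally surjective morphism with
   kernel I_k. *)
Record truncation (P : graded_limit) (k : nat) := Truncation {
  trunc : gpresheaf K Z_weights T;
  trunc_isheaf : is_sheaf trunc;
  trunc_proj : sheaf_hom (limit P) trunc;
  trunc_proj_weight : weight_preserving trunc_proj;
  trunc_ker : forall (U : opens T) (f : limit P U),
    trunc_proj U f = 0 <-> higher_ideal k f;
  trunc_surj : forall (U : opens T) (g : trunc U),
    locally_on (fun V (VU : V `<=` U) =>
      exists f : limit P V, trunc_proj V f = res trunc VU g)
}.

End GradedManifolds.

(* The dimension of V_i, with m coordinates in even and n in odd weights. *)
Definition alternating_dim (m n i : nat) : nat := if odd i then n else m.

Record covering (m n : nat) (M : supermanifold m n) := Covering {
  cov_total : graded_limit (sm_space M);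
  cov_trunc : forall k, truncation cov_total k;
  cov_proj : forall k, sheaf_hom (trunc (cov_trunc k.+1)) (trunc (cov_trunc k));
  cov_projE : forall k U f,
    cov_proj k U (trunc_proj (cov_trunc k.+1) U f) = trunc_proj (cov_trunc k) U f;
  cov_map : forall k, sheaf_hom (sm_sheaf M) (trunc (cov_trunc k));
  cov_map_parity : forall k, parity_preserving (cov_map k);
  cov_map_proj : forall k U f, cov_proj k U (cov_map k.+1 U f) = cov_map k U f;
  cov_atlas : exists (L : Type) (U : L -> opens (sm_space M))
    (Om : L -> opens 'rV[K]_m)
    (chi : forall l, space_iso (sm_sheaf M) (superdomain m n) (U l) (Om l))
    (Om' : L -> nat -> opens 'rV[K]_(alternating_dim m n 0))
    (psi : forall l r, space_iso (term cov_total r)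
       (graded_domain r (alternating_dim m n)) (U l) (Om' l r))
    (y : forall l i, 'I_(alternating_dim m n i) -> limit cov_total (U l)),
    [/\ forall x, exists l, oset (U l) x,
        forall l r i (ir : (i <= r)%N) (a : 'I_(alternating_dim m n i)),
          limit_in cov_total r (U l)
            (iso_pullback (psi l r)
              (@graded_coord r (alternating_dim m n) (Om' l r) i ir a)) = y l i a &
        forall l k i (a : 'I_(alternating_dim m n i)), (i <= k)%N ->
          @pr _ Z_weights _ (trunc (cov_trunc k)) (U l) i
            (cov_map k (U l)
              (iso_pullback (chi l) (@super_coord m n (Om l) (odd i) a))) =
          trunc_proj (cov_trunc k) (U l) (y l i a)]
}.

End Domains.

(* Main.v *)
Require Import Defs.
From mathcomp Require Import all_boot all_order all_algebra.
From mathcomp Require Import all_classical all_reals all_analysis.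

(** The kernel of the covering morphism is an ideal sheaf, and a nonzero ideal
    sheaf of a supermanifold of odd dimension n contains, on some nonempty open
    set of a chart, the product xi_1 ... xi_n of all the odd coordinates
    ([top_in_ideal]). So injectivity reduces to showing that xi_1 ... xi_n is
    nowhere killed.

    To reach xi_1 ... xi_n from a nonzero section f = sum_S f_S xi^S, choose S
    of minimal size with f_S nonzero at some point. Multiplying f by the odd
    coordinates outside S leaves only f_S xi_1 ... xi_n, up to sign
    ([minimal_coef_socle]), and f_S is invertible near that point because the
    stalks are local rings ([nonvanishing_invertible]).

    The covering morphism sends xi_b to a section without component of weight 0,
    by parity, and with component eta_b of weight 1, by the definition of a
    covering. So the component of weight n of the image of xi_1 ... xi_n is the
    class of eta_1 ... eta_n. Since n <= k, that weight is not affected by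
    dividing out the functions of weight above k, and eta_1 ... eta_n is a
    nonzero monomial in the graded coordinates ([cov_map_top_neq0]). *)

Set Implicit Arguments.
Unset Strict Implicit.
Unset Printing Implicit Defensive.

Import GRing.Theory.
Import numFieldNormedType.Exports.

Local Open Scope classical_set_scope.
Local Open Scope ring_scope.

(** * Sheaves graded by nonnegative weights *)

Section Sheaf.
Variables (K : comPzRingType) (I : weights) (T : topologicalType).
Variable O : gpresheaf K I T.

Lemma sheaf_local_eq (U : opens T) (f g : O U) : is_sheaf O ->
  locally_on (fun V (VU : V `<=` U) => res O VU f = res O VU g) -> f = g.
Proof.
move=> shO loc.
pose J := {V : opens T & {VU : V `<=` U | res O VU f = res O VU g}}.
apply: (shO J U (fun j => projT1 j) (fun j => sval (projT2 j)) _).1 => [x Ux|j].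
  by have [V [VU [Vx e]]] := loc x Ux; exists (existT _ V (exist _ VU e)).
exact: svalP (projT2 j).
Qed.

Lemma pr_zero (U : opens T) i : pr O i (0 : O U) = 0.
Proof. by apply: (addrI (pr O i 0)); rewrite -prD !addr0. Qed.

Lemma pr_sum (U : opens T) (A : Type) (s : seq A) (F : A -> O U) i :
  pr O i (\sum_(a <- s) F a) = \sum_(a <- s) pr O i (F a).
Proof. exact: (big_morph (pr O i) (@prD _ _ _ O U i) (pr_zero U i)). Qed.

(** A decomposition into components found on V stays valid on every smaller W;
    this brings two sections to a common neighbourhood. *)
Lemma res_finite_sum (U V W : opens T) (VU : V `<=` U) (WV : W `<=` V) (WU : W `<=` U)
    (f : O U) (s : seq I) :
  res O VU f = \sum_(i <- s) res O VU (pr O i f) ->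
  res O WU f = \sum_(i <- s) pr O i (res O WU f).
Proof.
move=> es; rewrite -{1}(res_comp VU WV WU) es rmorph_sum /=.
by apply: eq_bigr => i _; rewrite res_comp res_pr.
Qed.

End Sheaf.

Lemma sum_cauchy_delta (R : pzRingType) (q a b : nat) (x y : R) :
  \sum_(i < q.+1) (if i == a :> nat then x else 0) * (if (q - i)%N == b then y else 0)
  = if q == (a + b)%N then x * y else 0.
Proof.
have [->|qab] := eqVneq q (a + b)%N.
  have la : (a < (a + b).+1)%N by rewrite ltnS leq_addr.
  rewrite (bigD1 (Ordinal la)) //= addKn !eqxx big1 ?addr0 // => i ia.
  by rewrite ifN ?mul0r.
rewrite big1 // => i _; have [e|] := eqVneq; rewrite ?mul0r //.
have [e'|] := eqVneq; rewrite ?mulr0 //; case/eqP: qab.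
by rewrite -e -e' subnKC // -ltnS.
Qed.

Section Weights.
Variables (K : comPzRingType) (T : topologicalType).
Implicit Types (O : gpresheaf K Z_weights T) (U : opens T).

(** Compatibility of the product with the grading, written as a finite Cauchy
    product because weights are nonnegative. Unlike the decomposition of
    sections into homogeneous components, which exists only locally, this is an
    identity between sections; it is what passes to the quotient sheaves. *)
Definition cauchy_products O : Prop := forall U (q : nat) (f g : O U),
  pr O q (f * g) =
  \sum_(i < q.+1) pr O i f * pr O (q - i)%N g.

Definition unit_weight0 O : Prop :=
  forall U, pr O 0%N (1 : O U) = 1.

(** Both sides are biadditive, and locally each factor is a finite sum of
    homogeneous sections; for homogeneous factors of weights a and b both sides
    are their product if q = a + b and 0 otherwise. *)
Lemma superalgebra_cauchy O : is_sheaf O -> is_superalgebra O -> cauchy_products O.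
Proof.
move=> shO [prpr fin homM _] U q f g.
apply: (sheaf_local_eq shO) => x Ux.
have [V [VU [Vx [s [_ es]]]]] := fin U f x Ux.
have [V' [V'U [V'x [t [_ et]]]]] := fin U g x Ux.
pose X := Opens (openI (open_oset V) (open_oset V')).
have XV : X `<=` V by move=> y [].
have XV' : X `<=` V' by move=> y [].
have XU : X `<=` U by move=> y /XV /VU.
exists X, XU; split; first by split.
rewrite res_pr rmorphM rmorph_sum /=.
under eq_bigr => i _ do rewrite rmorphM /= !res_pr.
rewrite (res_finite_sum XV XU es) (res_finite_sum XV' XU et).
rewrite mulr_suml pr_sum.
under [RHS]eq_bigr => i _ do rewrite pr_sum mulr_suml.
rewrite exchange_big /=; apply: eq_bigr => a _.
rewrite mulr_sumr pr_sum.
under [RHS]eq_bigr => i _ do rewrite pr_sum mulr_sumr.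
rewrite exchange_big /=; apply: eq_bigr => b _.
set fa := pr O a _; set gb := pr O b _.
have hfa : @homogeneous K Z_weights T O X a fa by rewrite /homogeneous prpr eqxx.
have hgb : @homogeneous K Z_weights T O X b gb by rewrite /homogeneous prpr eqxx.
rewrite -(homM _ _ _ _ _ hfa hgb) prpr.
under eq_bigr => i _ do rewrite /fa /gb !prpr -/fa -/gb.
rewrite [RHS](sum_cauchy_delta q a b fa gb).
rewrite (homM _ _ _ _ _ hfa hgb); reflexivity.
Qed.

(** The weight q part of f = f * 1, for f of weight q, is f * pr 0 1. So pr 0 1
    is a right unit for homogeneous sections, hence for 1, which is locally a
    sum of such sections. *)
Lemma superalgebra_unit O : is_sheaf O -> is_superalgebra O -> unit_weight0 O.
Proof.
move=> shO supO U; have cO := superalgebra_cauchy shO supO.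
have [prpr fin _ _] := supO.
have absorb (V : opens T) (q : nat) (f : O V) :
    pr O q f * pr O 0%N 1 = pr O q f.
  have prq (i : nat) : pr O i (pr O q f) = if i == q then pr O q f else 0.
    exact: prpr.
  have := cO V q (pr O q f) 1; rewrite mulr1 prq eqxx => {2}->.
  rewrite big_ord_recr /= subnn prq eqxx big1 ?add0r // => i _.
  by rewrite prq ltn_eqF // mul0r.
apply: (sheaf_local_eq shO) => x Ux.
have [V [VU [Vx [s [_]]]]] := fin U 1 x Ux.
rewrite rmorph1 => e1.
exists V, VU; split=> //; rewrite res_pr rmorph1 -[LHS]mul1r {1}e1 mulr_suml [RHS]e1.
by apply: eq_bigr => i _; rewrite res_pr rmorph1 absorb.
Qed.

Definition order_ge O U (p : nat) (f : O U) : Prop :=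
  forall i : nat, (i < p)%N -> pr O i f = 0.

Lemma order_ge0 O U (f : O U) : order_ge 0 f.
Proof. by []. Qed.

Lemma order_geM O U (p q : nat) (f g : O U) : cauchy_products O ->
  order_ge p f -> order_ge q g -> order_ge (p + q) (f * g).
Proof.
move=> cO pf qg i ipq; rewrite cO big1 // => j _.
have [jp|pj] := ltnP j p; first by rewrite pf ?mul0r.
have -> : pr O (i - j)%N g = 0; last by rewrite mulr0.
apply: qg; rewrite ltn_subLR; last by rewrite -ltnS.
by apply: leq_trans ipq _; rewrite leq_add2r.
Qed.

(** In the Cauchy product of weight p + q every term but one has a factor below
    its order. *)
Lemma pr_lowest O U (p q : nat) (f g : O U) : cauchy_products O ->
  order_ge p f -> order_ge q g -> pr O (p + q)%N (f * g) =
  pr O p f * pr O q g.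
Proof.
move=> cO pf qg; have lp : (p < (p + q).+1)%N by rewrite ltnS leq_addr.
rewrite cO (bigD1 (Ordinal lp)) //= addKn big1 ?addr0 // => j jp.
have [ltjp|] := ltnP j p; first by rewrite pf ?mul0r.
rewrite leq_eqVlt => /orP[/eqP e|pj].
  by case/eqP: jp; apply: val_inj.
have -> : pr O (p + q - j)%N g = 0; last by rewrite mulr0.
by apply: qg; rewrite ltn_subLR; [rewrite ltn_add2r|rewrite -ltnS].
Qed.

Lemma pr_prod O U (A : Type) (s : seq A) (F : A -> O U) :
  cauchy_products O -> unit_weight0 O -> (forall a, order_ge 1 (F a)) ->
  pr O (size s) (\prod_(a <- s) F a) =
  \prod_(a <- s) pr O 1%N (F a).
Proof.
move=> cO uO F1.
suff [] : order_ge (size s) (\prod_(a <- s) F a) /\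
  pr O (size s) (\prod_(a <- s) F a) =
  \prod_(a <- s) pr O 1%N (F a) by [].
elim: s => [|a s [IHo IHp]]; first by rewrite !big_nil uO; split.
rewrite !big_cons /= -add1n; split; first exact: order_geM.
by rewrite pr_lowest // IHp.
Qed.

End Weights.

(** * Truncations and charts *)

Section Truncation.
Variables (R : realType) (c : ground) (T : topologicalType).
Variables (P : graded_limit R c T) (k : nat) (t : truncation P k).

(** Sections of the quotient lift locally to the limit, where the identity is
    known, and the projection preserves weights. *)
Lemma truncation_cauchy : cauchy_products (trunc t).
Proof.
have cP := superalgebra_cauchy (limit_isheaf P) (limit_super P).
move=> U q f g; apply: (sheaf_local_eq (trunc_isheaf t)) => x Ux.
have [V [VU [Vx [f' ef]]]] := trunc_surj f Ux.
have [V' [V'U [V'x [g' eg]]]] := trunc_surj g Ux.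
pose X := Opens (openI (open_oset V) (open_oset V')).
have XV : X `<=` V by move=> y [].
have XV' : X `<=` V' by move=> y [].
have XU : X `<=` U by move=> y /XV /VU.
exists X, XU; split; first by split.
rewrite res_pr rmorphM rmorph_sum /=.
under eq_bigr => i _ do rewrite rmorphM /= !res_pr.
rewrite -(res_comp VU XV XU) -(res_comp V'U XV' XU) -ef -eg !hom_res.
rewrite -rmorphM /= -trunc_proj_weight cP rmorph_sum /=.
by apply: eq_bigr => i _; rewrite rmorphM /= !trunc_proj_weight.
Qed.

Lemma truncation_unit : unit_weight0 (trunc t).
Proof.
move=> U; have uP := superalgebra_unit (limit_isheaf P) (limit_super P).
by rewrite -(rmorph1 (trunc_proj t U)) -trunc_proj_weight uP.
Qed.

(** Multiplication cannot lower the order, so the ideal generated by weights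
    above k has no component of weight at most k. Hence the
    truncation O / I_k loses nothing in weights up to k. *)
Lemma higher_ideal_order (U : opens T) (f : limit P U) :
  higher_ideal k f -> order_ge k.+1 f.
Proof.
have cP := superalgebra_cauchy (limit_isheaf P) (limit_super P).
have [prpr _ _ _] := limit_super P.
move=> If i ik; apply: (sheaf_local_eq (limit_isheaf P)) => x Ux.
have [V [VU [Vx [N [a [g [b [Sg ef]]]]]]]] := If x Ux.
exists V, VU; split=> //; rewrite res_pr ef pr_sum rmorph0.
apply: big1 => j _.
have g_order : order_ge k.+1 (g j).
  have [q [kq hq]] := Sg j; move=> i' i'k; rewrite -hq.
  rewrite (prpr V i' q (g j)) ifN //; rewrite -[_ == _]/(i' == q :> nat).
  by rewrite neq_ltn (leq_trans i'k).
have := order_geM cP (order_geM cP (order_ge0 (a j)) g_order) (order_ge0 (b j)).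
by rewrite add0n addn0; move=> /(_ i ik).
Qed.

End Truncation.

Section SpaceIso.
Variables (K : comPzRingType) (I : weights) (X Y : topologicalType).
Variables (OX : gpresheaf K I X) (OY : gpresheaf K I Y) (U : opens X) (Om : opens Y).
Variable (chi : space_iso OX OY U Om).

(** The image is the preimage of V under the continuous inverse, cut down to the
    open set Om. It is needed because sections are transported only between
    open sets. *)
Lemma iso_open_image (V : opens X) : V `<=` U ->
  exists2 W : opens Y, iso_fun chi @` V = W & W `<=` Om.
Proof.
move=> VU.
have imE : iso_fun chi @` V = Om `&` iso_inv chi @^-1` V.
  rewrite -(iso_img chi); apply/seteqP; split=> [_ [x Vx <-]|_ [[x Ux <-]]] /=.
    by split; [exists x => //; exact: VU|rewrite /= iso_funK //; exact: VU].
  by rewrite iso_funK // => Vx; exists x.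
have oW : open (iso_fun chi @` V).
  rewrite imE; have /continuousP cont := @iso_inv_cont _ _ _ _ _ _ _ _ chi.
  have /open_subspaceP[B oB eB] := cont _ (open_oset V).
  by rewrite setIC -eB; exact: openI oB (open_oset Om).
exists (Opens oW) => //= _ [x Vx <-].
by rewrite -(iso_img chi); exists x => //; exact: VU.
Qed.

Lemma iso_pullback_res (V : opens X) (W : opens Y) (VU : V `<=` U)
    (VW : iso_fun chi @` V = W) (WO : W `<=` Om) (s : OY Om) :
  res OX VU (iso_pullback chi s) = iso_map chi VU VW (res OY WO s).
Proof. exact: iso_map_res. Qed.

End SpaceIso.

(** * Monomials in the coordinates of a chart *)

Section Monomials.
Variables (R : realType) (c : ground) (m : nat) (G : finType) (w : G -> nat).
Variable I : weights.
Local Notation K := (scalars R c).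
Local Notation Km := 'rV[K]_m.
Local Notation O := (@model_sheaf R c m G w I).
Local Notation expo := {ffun G -> nat}.
Local Notation gen W g := (@gen_coord R c m G w I W g).
Implicit Types (W : opens Km) (r : seq G) (v : expo).

(** The value of s at z, which forgets that s is a section. A separate name is
    used because s coerces to a function, and a product written under that
    coercion would be read as a product of functions instead of sections. *)
Definition at_point W (s : O W) (z : W) : ssym K w := model_val s z.
Arguments at_point : simpl never.

Definition unit_expo (g : G) : expo := [ffun h => nat_of_bool (h == g)].
Definition indicator r : expo := [ffun h => nat_of_bool (h \in r)].

Lemma reduced_indicator r : reduced w (indicator r).
Proof. by apply/forallP => g; rewrite ffunE; case: (g \in r); rewrite implybT. Qed.

Lemma section_ext W (s t : O W) :
  (forall (z : W) v, reduced w v ->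
     coef (at_point s z) v = coef (at_point t z) v) -> s = t.
Proof.
move=> st; apply: val_inj; apply/funext => z; apply/funext => u.
by have := st z _ (valP u); rewrite !Defs.coefE.
Qed.

Lemma coef_gen W g (z : W) v : reduced w v ->
  coef (at_point (gen W g) z) v = if v == unit_expo g then 1 else 0.
Proof. by move=> rv; rewrite -[v in LHS](SubK (monomial w) rv) Defs.coefE. Qed.

(** The sign depends on the monomial only, not on the section or the point; the
    quantifiers are ordered so as to record this. *)
Lemma coef_mul_gen g v : reduced w v -> exists e : nat,
  forall W (s : O W) (z : W), coef (at_point (s * gen W g) z) v =
    if (0 < v g)%N then (-1) ^+ e * coef (at_point s z) (sub_expo v (unit_expo g))
    else 0.
Proof.
move=> rv; set d := sub_expo v (unit_expo g).
exists (swaps w d (sub_expo v d)) => W s z.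
have -> : at_point (s * gen W g) z = at_point s z * at_point (gen W g) z by [].
rewrite coef_mul //.
have coefg a : coef (at_point (gen W g) z) (sub_expo v a) =
    if sub_expo v a == unit_expo g then 1 else 0.
  exact/coef_gen/(reduced_dvd (dvd_sub_expo v a)).
under eq_bigr => a _ do rewrite coefg.
have [vg|] := ltnP 0 (v g).
  have dv : d \in divisors_expo v by rewrite mem_divisors dvd_sub_expo.
  have subd : sub_expo v d = unit_expo g.
    by apply/ffunP => h; rewrite !ffunE subKn //; case: eqP => // ->.
  rewrite (bigD1_seq d) ?uniq_divisors //= subd eqxx mulr1 -big_filter.
  rewrite big1_seq ?addr0 // => a /=; rewrite mem_filter mem_divisors.
  move=> /andP[ad /forallP av]; rewrite ifN ?mulr0 //.
  apply: contra ad => /eqP/ffunP e; apply/eqP/ffunP => h.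
  by have := e h; rewrite !ffunE => <-; rewrite subKn.
rewrite leqn0 => /eqP vg; rewrite big1 // => a _; rewrite ifN ?mulr0 //.
by apply/eqP => /ffunP/(_ g); rewrite !ffunE eqxx vg.
Qed.

Lemma coef_mul_gens r v : uniq r -> reduced w v -> exists e : nat,
  forall W (s : O W) (z : W),
    coef (at_point (s * \prod_(g <- r) gen W g) z) v =
    if all (fun g => 0 < v g)%N r
    then (-1) ^+ e * coef (at_point s z) (sub_expo v (indicator r)) else 0.
Proof.
move=> + rv; elim: r => [_|g r IH /= /andP[gr /IH[e1 ih]]].
  exists 0%N => W s z; rewrite big_nil mulr1 expr0 mul1r; congr coef.
  by apply/ffunP => h; rewrite !ffunE subn0.
have [e2 step] := coef_mul_gen g (reduced_dvd (dvd_sub_expo v (indicator r)) rv).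
exists (e1 + e2)%N => W s z.
rewrite big_cons mulrA ih step !ffunE (negPf gr) subn0.
have -> : sub_expo (sub_expo v (indicator r)) (unit_expo g) =
    sub_expo v (indicator (g :: r)).
  apply/ffunP => h; rewrite !ffunE in_cons -subnDA; congr (_ - _)%N.
  by case: eqP gr => [->|]; case: (_ \in r).
rewrite exprD -mulrA /=; case: (all _ r); last by rewrite andbF.
by case: ifP => //=; rewrite mulr0.
Qed.

(** Distinct generators, odd or even, have a nonzero product: its coefficient
    at the monomial in which each of them occurs once is a sign. *)
Lemma prod_gens_neq0 r W (z : W) : uniq r -> \prod_(g <- r) gen W g <> 0.
Proof.
move=> ur p0; have [e ce] := coef_mul_gens ur (reduced_indicator r).
have := ce W 1 z; rewrite mul1r p0 ifT; last first.
  by apply/allP => g gr; rewrite ffunE gr.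
have -> : coef (at_point 0 z) (indicator r) = 0.
  by rewrite -(SubK (monomial w) (reduced_indicator r)) Defs.coefE.
have -> : coef (at_point 1 z) (sub_expo (indicator r) (indicator r)) = 1.
  have -> : sub_expo (indicator r) (indicator r) = [ffun=> 0%N].
    by apply/ffunP => h; rewrite !ffunE subnn.
  have r0 : reduced w [ffun=> 0%N].
    by apply/forallP => h; rewrite ffunE implybT.
  rewrite -(SubK (monomial w) r0) Defs.coefE.
  rewrite [LHS](_ : _ = ssym_const (1 : K) (Sub _ r0 : monomial w)) //.
  by rewrite /ssym_const SubK eqxx.
move/eqP; rewrite mulr1 eq_sym => /eqP e0.
by have := signr_eq0 K e; rewrite e0 eqxx.
Qed.

Lemma coef_signM W e (s : O W) (z : W) v :
  coef (at_point ((-1) ^+ e * s) z) v = (-1) ^+ e * coef (at_point s z) v.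
Proof.
rewrite -[in LHS]signr_odd -[in RHS]signr_odd.
case: (odd e); rewrite ?expr0 ?mul1r // expr1 !mulN1r /coef.
have -> : at_point (- s) z = - at_point s z by [].
by case: insub => //=; rewrite oppr0.
Qed.

(** In an exterior algebra over a ring, a nonzero element can be pushed into the
    top degree. Let f_S xi^S be a term of s with S of minimal weight. Multiplying
    by the odd generators outside S kills the terms xi^T with T not contained in
    S, and T strictly contained in S does not occur by minimality; what remains
    is, up to sign, f_S times the product of all the generators. The factor p
    is the product of the generators outside S, with that sign. *)
Lemma minimal_coef_socle W (s : O W) (u : monomial w) : (forall g, odd (w g)) ->
  (forall (z : W) (u' : monomial w),
     (weight w (val u') < weight w (val u))%N -> at_point s z u' = 0) ->
  exists p : O W, s * p =
    (model_fun w ((model_secP s).1 u) : O W) * \prod_(g <- enum G) gen W g.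
Proof.
move=> oddw small; pose r := [seq g <- enum G | val u g == 0%N].
set F : O W := model_fun _ _.
suff [e se] : exists e : nat, s * \prod_(g <- r) gen W g =
    (-1) ^+ e * (F * \prod_(g <- enum G) gen W g).
  exists (\prod_(g <- r) gen W g * (-1) ^+ e).
  by rewrite mulrA se commr_sign mulrA -expr2 sqrr_sign mul1r.
have ur : uniq r by rewrite filter_uniq ?enum_uniq.
have memr g : (g \in r) = (val u g == 0%N) by rewrite mem_filter mem_enum andbT.
have le1 v g : reduced w v -> (v g <= 1)%N.
  by move=> /forallP/(_ g); rewrite oddw.
(* The only reduced exponent in which every generator occurs. *)
pose top := indicator (enum G).
have rtop : reduced w top := reduced_indicator _.
have [e1 ce1] := coef_mul_gens ur rtop.
have [e2 ce2] := coef_mul_gens (enum_uniq G) rtop.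
exists (e1 + e2)%N; apply: section_ext => z v rv; rewrite coef_signM.
have coef_const a :
    coef (at_point (model_fun w ((model_secP s).1 u)) z) a =
    if a == [ffun=> 0%N] then at_point s z u else 0.
  have [ra|ra] := boolP (reduced w a).
    by rewrite -[a in LHS](SubK (monomial w) ra) Defs.coefE.
  rewrite coef_out //; case: eqP ra => // -> /negP[].
  by apply/forallP => h; rewrite ffunE implybT.
have [->|vtop] := eqVneq v top.
  rewrite ce1 ce2 !ifT; last 2 first.
  - by apply/allP => g _; rewrite ffunE mem_enum.
  - by apply/allP => g _; rewrite ffunE mem_enum.
  have -> : sub_expo top (indicator r) = val u.
    apply/ffunP => g; rewrite !ffunE mem_enum memr.
    by have := le1 _ g (valP u); case: (val u g) => [|[|]].
  rewrite Defs.coefE coef_const ifT; last first.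
    by apply/eqP/ffunP => g; rewrite !ffunE subnn.
  by rewrite exprD -mulrA (mulrA ((-1) ^+ e2)) -expr2 sqrr_sign mul1r.
have [e3 ->] := coef_mul_gens ur rv.
have [e4 ->] := coef_mul_gens (enum_uniq G) rv.
(* Below the top exponent the right-hand side vanishes. On the left, a nonzero
   coefficient would be that of a monomial strictly dividing u. *)
have [g vg] : exists g, v g = 0%N.
  apply: contrapT => nv; case/eqP: vtop; apply/ffunP => g.
  rewrite ffunE mem_enum; have := le1 v g rv.
  case vg : (v g) => [|[|]] // _; by case: nv; exists g.
rewrite [in RHS]ifN; last first.
  by apply/allPn; exists g; rewrite ?mem_enum // vg.
rewrite mulr0; case: ifP => // /allP vr.
have [ra|ra] := boolP (reduced w (sub_expo v (indicator r))); last first.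
  by rewrite coef_out ?mulr0.
rewrite -(SubK (monomial w) ra) Defs.coefE small ?mulr0 // SubK.
have au : dvd_expo (sub_expo v (indicator r)) (val u).
  apply/forallP => h; rewrite !ffunE memr; have := le1 v h rv.
  by case: (val u h) (v h) => [|n'] [|[|]].
rewrite (weight_sub w au) -addn1 leq_add2l.
rewrite /weight (bigD1 g) //= addn_gt0 muln_gt0 odd_gt0 //=.
rewrite !ffunE vg sub0n subn0 lt0n; apply/orP; left.
by apply/negP => ug; have := vr g; rewrite memr ug vg => /(_ isT).
Qed.

End Monomials.

(** * The image of the product of the odd coordinates *)

Lemma pr_gen (R : realType) (c : ground) (m : nat) (G : finType) (w : G -> nat)
    (I : weights) (W : opens 'rV[scalars R c]_m) (i : I) (g : G) :
  pr (@model_sheaf R c m G w I) i (gen_coord w I W g) =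
  if of_nat I (w g) == i then gen_coord w I W g else 0.
Proof.
have wg : weight w (unit_expo g) = w g.
  rewrite /weight (bigD1 g) //= ffunE eqxx muln1 big1 ?addn0 // => h hg.
  by rewrite ffunE (negPf hg) muln0.
apply: section_ext => z v rv.
have prE (s : @model_sheaf R c m G w I W) :
    coef (at_point (pr (@model_sheaf R c m G w I) i s) z) v =
    if of_nat I (weight w v) == i then coef (at_point s z) v else 0.
  by rewrite -(SubK (monomial w) rv) !Defs.coefE.
rewrite prE coef_gen //.
have c0 : coef (at_point (0 : @model_sheaf R c m G w I W) z) v = 0.
  by rewrite -(SubK (monomial w) rv) Defs.coefE.
have [e|vg] := eqVneq v (unit_expo g).
  rewrite e wg; rewrite e in rv c0.
  by case: ifP => _; rewrite ?c0 // coef_gen // eqxx.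
by case: ifP => _; case: ifP => _; rewrite ?c0 // coef_gen // (negPf vg).
Qed.

Section TopProduct.
Variables (R : realType) (c : ground) (m n : nat).
Local Notation K := (scalars R c).
Local Notation d := (alternating_dim m n).
Variables (M : supermanifold R c m n) (P : covering M) (k : nat).
Hypothesis nk : (n <= k)%N.
Local Notation total := (cov_total P).
Local Notation T := (sm_space M).
Variables (U : opens T) (Om : opens 'rV[K]_m) (Om' : opens 'rV[K]_(d 0%N)).
Variables (chi : space_iso (sm_sheaf M) (superdomain R c m n) U Om).
Variables (psi : space_iso (term total 1) (graded_domain R c 1 d) U Om').

Let xi (a : 'I_n) : sm_sheaf M U :=
  iso_pullback chi (super_coord Om (e := true) a).
Let eta (a : 'I_n) : term total 1 U :=
  iso_pullback psi (@graded_coord R c 1 d Om' 1 isT a).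

(** The covering condition in weight 1 for the odd coordinates. *)
Hypothesis leading : forall a : 'I_n,
  @pr K Z_weights T (trunc (cov_trunc P k)) U 1%N (cov_map P k U (xi a)) =
  trunc_proj (cov_trunc P k) U (limit_in total 1 U (eta a)).

Lemma pr_eta a (i : nat) :
  pr (term total 1) i (eta a) = if i == 1%N then eta a else 0.
Proof.
rewrite /eta /iso_pullback iso_map_pr.
have -> : pr (graded_domain R c 1 d) i (@graded_coord R c 1 d Om' 1 isT a) =
    if i == 1%N then @graded_coord R c 1 d Om' 1 isT a else 0.
  by rewrite eq_sym; exact: pr_gen.
by case: ifP => // _; rewrite rmorph0.
Qed.

Lemma pr_xi a : pr (sm_sheaf M) false (xi a) = 0.
Proof.
rewrite /xi /iso_pullback iso_map_pr.
have -> : pr (superdomain R c m n) false (super_coord Om (e := true) a) = 0.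
  exact: pr_gen.
by rewrite rmorph0.
Qed.

(** The image of an odd coordinate is odd, and weight 0 is even, so the image
    starts in weight 1. *)
Lemma order_cov_xi a : order_ge 1 (cov_map P k U (xi a)).
Proof.
have odd_xi : has_parity true (xi a) by case => // _; exact: pr_xi.
by case=> // _; exact: (cov_map_parity P k odd_xi).
Qed.

Lemma prod_eta_neq0 (V : opens T) (VU : V `<=` U) (x : T) : oset V x ->
  \prod_(a <- enum 'I_n) res (term total 1) VU (eta a) <> 0.
Proof.
move=> Vx.
have [W VW WO] := iso_open_image psi VU.
have Wx : oset W (iso_fun psi x) by rewrite -VW; exists x.
pose z : W := exist _ (iso_fun psi x) (mem_set Wx).
pose lift (a : 'I_n) : generator 1 d := Tagged (fun i : 'I_1 => 'I_(d i.+1))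
  (a : 'I_(d (Ordinal (isT : (0 < 1)%N)).+1)).
have lift_inj : injective lift.
  by move=> a b /eqP; rewrite eq_Tagged => /eqP.
(* Read on the chart, the product is one of distinct generators. *)
have -> : \prod_(a <- enum 'I_n) res (term total 1) VU (eta a) =
    iso_map psi VU VW (\prod_(g <- map lift (enum 'I_n))
      gen_coord (@gen_weight 1 d) Z_weights W g).
  rewrite rmorph_prod /= big_map; apply: eq_bigr => a _.
  rewrite (iso_pullback_res VU VW WO); congr (iso_map psi VU VW _).
  exact: val_inj.
rewrite -(rmorph0 (iso_map psi VU VW)) => /(bij_inj (iso_map_bij VU VW)).
by apply: prod_gens_neq0 z _; rewrite map_inj_uniq ?enum_uniq.
Qed.

(** The component of weight n of the image of xi_1 ... xi_n is the product of the
    components of weight 1 of the factors, that is, the class of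
    eta_1 ... eta_n. As n <= k, that product is not in I_k: an element of I_k
    has no component of weight n, while eta_1 ... eta_n is a nonzero element
    homogeneous of weight n, as is visible on the graded chart of degree 1. *)
Lemma cov_map_top_neq0 (V : opens T) (VU : V `<=` U) (x : T) : oset V x ->
  cov_map P k V (\prod_(a <- enum 'I_n) res (sm_sheaf M) VU (xi a)) <> 0.
Proof.
move=> Vx; rewrite rmorph_prod /= => top0.
pose t := cov_trunc P k.
have sizeE : size (enum 'I_n) = n by rewrite size_enum_ord.
(* If the image vanished, so would its component of weight n. *)
have prodY : trunc_proj t V
    (limit_in total 1 V (\prod_(a <- enum 'I_n) res (term total 1) VU (eta a))) = 0.
  have o1 a : order_ge 1 (cov_map P k V (res (sm_sheaf M) VU (xi a))).
    by move=> i i1; rewrite -hom_res -res_pr order_cov_xi // rmorph0.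
  have := pr_prod (enum 'I_n) (@truncation_cauchy _ _ _ _ _ t) (truncation_unit t) o1.
  rewrite top0 pr_zero !rmorph_prod /= => ->; apply: eq_bigr => a _.
  by rewrite -!hom_res -res_pr leading.
have orderY := higher_ideal_order ((trunc_ker _ _).1 prodY).
have cP := superalgebra_cauchy (limit_isheaf total) (limit_super total).
have uP := superalgebra_unit (limit_isheaf total) (limit_super total).
have prY a (i : nat) :
    pr (limit total) i (limit_in total 1 V (res (term total 1) VU (eta a))) =
    if i == 1%N then limit_in total 1 V (res (term total 1) VU (eta a)) else 0.
  rewrite -limit_in_weight -res_pr pr_eta.
  by case: ifP => // _; rewrite !rmorph0.
have o1 a : order_ge 1 (limit_in total 1 V (res (term total 1) VU (eta a))).
  by case=> // _; rewrite prY.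
(* Each eta_a has weight 1, so their product is its own component of weight n. *)
have := pr_prod (enum 'I_n) cP uP o1.
rewrite -rmorph_prod orderY ?sizeE //.
under eq_bigr => a _ do rewrite prY eqxx.
rewrite -rmorph_prod -(rmorph0 (limit_in total 1 V)) => /limit_in_inj /esym.
exact: prod_eta_neq0 Vx.
Qed.

End TopProduct.

(** * Nonzero ideals contain the product of the odd coordinates *)

Section Socle.
Variables (R : realType) (c : ground) (m n : nat).
Local Notation K := (scalars R c).
Variables (M : supermanifold R c m n).
Local Notation T := (sm_space M).
Local Notation O := (sm_sheaf M).
Variables (U : opens T) (Om : opens 'rV[K]_m).
Variables (chi : space_iso O (superdomain R c m n) U Om).

(** The stalks of a supermanifold are local and a = f(z) is invertible, so one
    of g and a - g is invertible at x, where g is the section given by f. It is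
    not a - g, whose value at x is 0. Locality thus replaces the regularity
    of 1 / f. *)
Lemma nonvanishing_invertible (V : opens T) (VU : V `<=` U) (W : opens 'rV[K]_m)
    (VW : iso_fun chi @` V = W) (f : W -> K) (rf : regular f) (x : T) (z : W) :
  oset V x -> iso_fun chi x = val z -> f z <> 0 ->
  invertible_at x
    (iso_map chi VU VW (model_fun (fun _ : 'I_n => 1%N) rf : superdomain R c m n W)).
Proof.
move=> Vx xz fz; set F : superdomain R c m n W := model_fun _ rf.
set g := iso_map _ _ _ _.
have [_ loc] := sm_local Vx.
pose a : O V := alg_scalar (O V) (f z).
have : invertible_at x (g + (a - g)).
  exists V, (@subset_refl _ V); split=> //.
  exists (alg_scalar (O V) (f z)^-1).
  have fz0 : f z != 0 by exact/eqP.
  by rewrite addrC subrK res_id /a -!rmorphM /= mulfV // mulVf // rmorph1.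
case/loc => // -[V1 [V1V [V1x [h [e _]]]]]; exfalso.
have V1U : V1 `<=` U by move=> t /V1V /VU.
have [W1 VW1 _] := iso_open_image chi V1U.
have W1W : W1 `<=` W by rewrite -VW -VW1 => _ [t /V1V Vt <-]; exists t.
have W1z : oset W1 (val z) by rewrite -VW1 -xz; exists x.
have [inv invK Kinv] := iso_map_bij V1U VW1.
pose b : superdomain R c m n W1 :=
  alg_scalar (superdomain R c m n W1) (f z) - res (superdomain R c m n) W1W F.
have {}e : b * inv h = 1.
  apply: (bij_inj (iso_map_bij V1U VW1)); rewrite rmorphM rmorphB /= Kinv rmorph1.
  by rewrite -(iso_map_res VU VW V1U VW1 V1V W1W) alg_mapZ -e rmorphB /= /a alg_mapZ.
pose z1 : W1 := exist _ (val z) (mem_set W1z).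
have bz : at_point b z1 = ssym_const 0.
  apply/funext => u.
  transitivity (ssym_const (f z) u - ssym_const (f (sub_incl W1W z1)) u : K) => //.
  have -> : sub_incl W1W z1 = z by exact: val_inj.
  by rewrite subrr /ssym_const; case: ifP.
have r0 : reduced (fun _ : 'I_n => 1%N) [ffun=> 0%N].
  by apply/forallP => i; rewrite ffunE implybT.
have := congr1 (fun s => at_point s z1 (Sub _ r0)) e.
have -> : at_point (b * inv h) z1 = at_point b z1 * at_point (inv h) z1 by [].
rewrite bz ssym_constM mul0r.
have -> : at_point (1 : superdomain R c m n W1) z1 (Sub _ r0) =
    ssym_const (1 : K) (Sub _ r0 : monomial (fun _ : 'I_n => 1%N)) by [].
by rewrite /ssym_const SubK eqxx => /eqP; rewrite eq_sym oner_eq0.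
Qed.

Let xi (a : 'I_n) : O U := iso_pullback chi (super_coord Om (e := true) a).

(** Every nonzero ideal of the structure sheaf contains, near some point, the
    product of all the odd coordinates: by minimal_coef_socle it contains the
    product of the top monomial with a function not vanishing at some point,
    and near that point the function can be inverted. *)
Lemma top_in_ideal (V : opens T) (VU : V `<=` U) (f : O V) : f <> 0 ->
  exists (V1 : opens T) (V1V : V1 `<=` V) (V1U : V1 `<=` U) (x : T) (g h : O V1),
    oset V1 x /\ \prod_(a <- enum 'I_n) res O V1U (xi a) = g * (res O V1V f * h).
Proof.
move=> f0.
have [W VW WO] := iso_open_image chi VU.
have [inv _ Kinv] := iso_map_bij VU VW.
pose s := inv f; pose w := fun _ : 'I_n => 1%N.
pose nonzero N := `[< exists (z : W) (u : monomial w),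
  at_point s z u <> 0 /\ weight w (val u) = N >].
have exN : exists N, nonzero N.
  apply: contrapT => nex; apply: f0; rewrite -(Kinv f) -(rmorph0 (iso_map chi VU VW)).
  congr (iso_map chi VU VW _); apply: val_inj; apply/funext => z; apply/funext => u.
  apply: contrapT => szu; apply: nex; exists (weight w (val u)).
  by apply/asboolP; exists z, u.
case: (ex_minnP exN) => N /asboolP[z [u [szu uN]]] minN.
have small (z' : W) (u' : monomial w) :
    (weight w (val u') < weight w (val u))%N -> at_point s z' u' = 0.
  rewrite uN => u'N; apply: contrapT => szu'.
  have : nonzero (weight w (val u')) by apply/asboolP; exists z', u'.
  by move/minN; rewrite leqNgt u'N.
have [p soc] := @minimal_coef_socle _ _ _ _ w Z2_weights W s u (fun _ => isT) small.
have xiE a : res O VU (xi a) = iso_map chi VU VW (gen_coord w Z2_weights W a).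
  rewrite /xi (iso_pullback_res VU VW WO); congr (iso_map chi VU VW _).
  exact: val_inj.
have [x Vx xz] : (iso_fun chi @` V) (val z) by rewrite VW; exact: set_mem (valP z).
have := nonvanishing_invertible VU VW ((model_secP s).1 u) Vx xz szu.
set F : superdomain R c m n W := model_fun _ _.
move=> [V1 [V1V [V1x [h [_ hF]]]]].
have V1U : V1 `<=` U by move=> t /V1V /VU.
exists V1, V1V, V1U, x, h, (res O V1V (iso_map chi VU VW p)); split=> //.
(* Here h is the local inverse of the coefficient F. *)
have /(congr1 (iso_map chi VU VW)) := soc; rewrite !rmorphM /= Kinv.
move=> /(congr1 (fun t => h * res O V1V t)); rewrite !rmorphM /= => ->.
rewrite mulrA hF mul1r !rmorph_prod /=.
by apply: eq_bigr => a _; rewrite -xiE res_comp.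
Qed.

End Socle.

(** * Injectivity of the covering morphisms *)

Theorem theorem46 (R : realType) (c : ground) (m n : nat)
  (M : supermanifold R c m n) (P : covering M) (k : nat) (nk : (n <= k)%N) :
  forall U : opens (sm_space M), injective (cov_map P k U).
Proof.
move=> U0; suff ker0 (f : sm_sheaf M U0) : cov_map P k U0 f = 0 -> f = 0.
  by move=> f1 f2 e; apply/subr0_eq/ker0; rewrite rmorphB /= e subrr.
move=> ker.
have [L [U [Om [chi [Om' [psi [y [cover yE lead]]]]]]]] := cov_atlas P.
apply: (sheaf_local_eq (@sm_isheaf _ _ _ _ M)) => x U0x.
have [l Ulx] := cover x.
pose V := Opens (openI (open_oset U0) (open_oset (U l))).
have VU0 : V `<=` U0 by move=> t [].
have VU : V `<=` U l by move=> t [].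
exists V, VU0; split; first by split.
rewrite rmorph0; apply: contrapT => fV0.
have [V1 [V1V [V1U [x1 [g [h [V1x1 top]]]]]]] := top_in_ideal (chi l) VU fV0.
(* For n > 0 the condition 1 <= k of the atlas follows from n <= k. *)
have lead1 (a : 'I_n) : @pr _ Z_weights _ (trunc (cov_trunc P k)) (U l) 1%N
    (cov_map P k (U l) (iso_pullback (chi l) (super_coord (Om l) (e := true) a))) =
    trunc_proj (cov_trunc P k) (U l) (limit_in (cov_total P) 1 (U l)
      (iso_pullback (psi l 1%N)
        (@graded_coord R c 1 (alternating_dim m n) (Om' l 1%N) 1 isT a))).
  have k1 : (1 <= k)%N by apply: leq_trans nk; exact: leq_ltn_trans (ltn_ord a).
  by rewrite (yE l 1%N 1%N isT a); exact: lead l k 1%N a k1.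
apply: (cov_map_top_neq0 nk lead1 (VU := V1U) V1x1).
by rewrite top !rmorphM /= -!hom_res ker !rmorph0 mul0r mulr0.
Qed.
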